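(* Let $(X(t),T(t))_{t\ge0}$ be the joint KMP–temperature process described in the context, with $X(0)$ and $T(0)$ independent, $X(0)$ distributed according to $\mu^X$ (product of independent exponential random variables of mean $1$ on $\mathbb R_+^{\overline{\mathbb V}}$), and $T(0)$ distributed according to an arbitrary probability measure $\nu$ on $\{s\in\mathbb R_+^{\overline{\mathbb V}}: s_j=T_j\ \forall j\in\partial\mathbb V\}$. Then for every $t\ge0$, $X(t)$ and $T(t)$ are independent, and the marginal process $(T(t))_{t\ge0}$ has the law of the opinion process $O$ with initial distribution $\nu$. In particular $(X(t),T(t))$ has law $\mu^X(d\underline x)\,[\nu e^{tL^O}](d\underline s)$, where $\nu e^{tL^O}$ denotes the law at time $t$ of the opinion process started from $\nu$.
   Context: Graph: $(\overline{\mathbb V},\overline E)$ is a finite oriented graph; $\overline{\mathbb V}=\mathbb V\cup\partial\mathbb V$ (disjoint; internal and boundary vertices). There is at most one edge between any pair of vertices and if $ij\in\overline E$ then $ji\notin\overline E$. $E$ is the set of edges with both endpoints in $\mathbb V$, $\partial E$ the set of edges with one endpoint in $\partial\mathbb V$; there are no edges between two boundary vertices, and every boundary edge is written $ij$ with $i\in\mathbb V$, $j\in\partial\mathbb V$. $\overline E=E\cup\partial E$. Each $j\in\partial\mathbb V$ carries a fixed temperature $T_j>0$. Joint KMP–temperature process $(X,T)$ on $\mathbb R_+^{\overline{\mathbb V}}\times\mathbb R_+^{\overline{\mathbb V}}$: generator $L^{X,T}f(X,T)=\sum_{ij\in E}\int_0^1du\,[f(H_{i,j;u}(X,T))-f(X,T)]+\sum_{ij\in\partial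 E}\int_0^\infty db\,e^{-b}\int_0^1du\,[f(H_{i,j;b,u}(X,T))-f(X,T)]$, where, writing $\bar T:=\frac{X_i}{X_i+X_j}T_i+\frac{X_j}{X_i+X_j}T_j$: $H_{i,j;u}$ sets $(X_i,T_i)\to(u(X_i+X_j),\bar T)$, $(X_j,T_j)\to((1-u)(X_i+X_j),\bar T)$ and leaves other coordinates unchanged; $H_{i,j;b,u}$ (for $j\in\partial\mathbb V$) sets $(X_i,T_i)\to(u(X_i+X_j),\bar T)$, $(X_j,T_j)\to(b,T_j)$ and leaves other coordinates unchanged. Opinion process $O$ with boundary conditions $T_{\partial\mathbb V}$: Markov process on $\mathbb R_+^{\overline{\mathbb V}}$ with $O_j\equiv T_j$ for $j\in\partial\mathbb V$ and generator $L^Of(O)=\sum_{ij\in\overline E}\int_0^1dv\,[f(H^O_{ij;v}O)-f(O)]$, where $(H^O_{ij;v}O)_\ell=vO_i+(1-v)O_j$ for $\ell\in\{i,j\}\cap\mathbb V$ and $(H^O_{ij;v}O)_\ell=O_\ell$ otherwise. *)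

(* Defs.v *)
From HB Require Import structures.
From mathcomp Require Import all_boot all_order all_algebra.
From mathcomp Require Import all_classical all_reals all_analysis.
Set Implicit Arguments.
Unset Strict Implicit.
Unset Printing Implicit Defensive.
Import Order.TTheory GRing.Theory Num.Theory.
Import numFieldNormedType.Exports.
Local Open Scope classical_set_scope.
Local Open Scope ring_scope.

(* Vertex set \overline V = 'I_n ; a state (one real per vertex) is an
   n.-tuple R, carrying MathComp-Analysis' product sigma-algebra on tuples.
   bd : pred 'I_n is the boundary \partial V ; e : rel 'I_n is the oriented
   edge relation (e i j <-> ij \in \overline E). *)

Section Defs.
Context {R : realType} {n : nat}.
Notation S := (n.-tuple R).
Notation mu := (@lebesgue_measure R).

Definition graph_ok (bd : pred 'I_n) (e : rel 'I_n) : Prop :=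
  (forall i j, e i j -> ~~ e j i) /\      (* never both ij and ji (and no loops) *)
  (forall i j, e i j -> ~~ bd i).         (* boundary edges are ij with i internal,
                                             j boundary; no boundary-boundary edges *)

Definition upd2 (x : S) (i j : 'I_n) (a b : R) : S :=
  [tuple (if k == i then a else if k == j then b else tnth x k) | k < n].

Definition Tbar (X T : S) (i j : 'I_n) : R :=
  tnth X i / (tnth X i + tnth X j) * tnth T i
  + tnth X j / (tnth X i + tnth X j) * tnth T j.

Definition H_bulk (i j : 'I_n) (u : R) (z : S * S) : S * S :=
  let: (X, T) := z in
  (upd2 X i j (u * (tnth X i + tnth X j)) ((1 - u) * (tnth X i + tnth X j)),
   upd2 T i j (Tbar X T i j) (Tbar X T i j)).

Definition H_bd (i j : 'I_n) (b u : R) (z : S * S) : S * S :=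
  let: (X, T) := z in
  (upd2 X i j (u * (tnth X i + tnth X j)) b,
   upd2 T i j (Tbar X T i j) (tnth T j)).

Definition L_XT (bd : pred 'I_n) (e : rel 'I_n) (f : S * S -> R) : S * S -> R :=
  fun z =>
    \sum_(i < n) \sum_(j < n | e i j && ~~ bd j)
        Rintegral mu `[0, 1] (fun u => f (H_bulk i j u z) - f z)
  + \sum_(i < n) \sum_(j < n | e i j && bd j)
        Rintegral mu `[0, +oo[ (fun b => expR (- b) *
          Rintegral mu `[0, 1] (fun u => f (H_bd i j b u z) - f z)).

Definition H_O (bd : pred 'I_n) (i j : 'I_n) (v : R) (O : S) : S :=
  [tuple (if ((k == i) || (k == j)) && ~~ bd k
          then v * tnth O i + (1 - v) * tnth O j else tnth O k) | k < n].

Definition L_O (bd : pred 'I_n) (e : rel 'I_n) (f : S -> R) : S -> R :=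
  fun O => \sum_(i < n) \sum_(j < n | e i j)
     Rintegral mu `[0, 1] (fun v => f (H_O bd i j v O) - f O).

End Defs.

(* The Markov semigroup e^{tL} = \sum_k t^k L^k / k! of a (bounded) generator,
   acting on bounded measurable functions. *)
Definition expL {R : realType} {U : Type} (L : (U -> R) -> (U -> R))
  (t : R) (f : U -> R) : U -> R :=
  fun z => limn (series (fun k : nat => t ^+ k / k`!%:R * iter k L f z)).

(* Finite-dimensional expectations of the Markov process with semigroup P:
   for a list [(d1,g1);...;(dk,gk)] of time increments d_l >= 0 and test
   functions, [markov_chain P l z] = E_z[ \prod_l g_l(Y_{t_l}) ] with
   t_l = d1 + ... + d_l (Markov property). *)
Fixpoint markov_chain {R : realType} {U : Type}
  (P : R -> (U -> R) -> (U -> R)) (l : seq (R * (U -> R))) : U -> R :=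
  match l with
  | [::] => fun _ => 1
  | (d, g) :: l' => P d (fun z => g z * markov_chain P l' z)
  end.

Definition Eint {d} {U : measurableType d} {R : realType}
  (m : {measure set U -> \bar R}) (f : U -> R) : R :=
  fine (\int[m]_x (f x)%:E).

Definition bounded_meas {d} {U : measurableType d} {R : realType}
  (f : U -> R) : Prop :=
  measurable_fun [set: U] f /\ exists M : R, forall z, `|f z| <= M.

(* mu^X : the product of n independent Exp(1) laws on R^n (characterized on
   measurable boxes, which determines it). *)
Definition is_prod_exp1 {R : realType} {n : nat}
  (m : probability (n.-tuple R) R) : Prop :=
  forall A : 'I_n -> set R, (forall i, measurable (A i)) ->
    m [set x | forall i, A i (tnth x i)] =
    (\prod_(i < n) exponential_prob (1 : R) (A i))%E.

Definition adm_set {R : realType} {n : nat} (bd : pred 'I_n) (Tb : 'I_n -> R)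
  : set (n.-tuple R) :=
  [set s | forall i, 0 <= tnth s i /\ (bd i -> tnth s i = Tb i)].

(* Main.v *)
Require Import Defs.
From HB Require Import structures.
From mathcomp Require Import all_boot all_order all_algebra.
From mathcomp Require Import all_classical all_reals all_analysis.
From mathcomp Require Import measurable_realfun ring.
Import Order.TTheory GRing.Theory Num.Theory.
Import numFieldNormedType.Exports.
Local Open Scope classical_set_scope.
Local Open Scope ring_scope.
Set Implicit Arguments.
Unset Strict Implicit.
Unset Printing Implicit Defensive.

(* Write (A f)(s) for the average of f(x, s) over x drawn from mu^X.  The point
   is that A intertwines the two generators, A L^{X,T} = L^O A, for every s.
   Per edge this is the classical fact that for independent exponentials a and b
   the fraction a / (a + b) is uniform and independent of a + b, hence also of
   the pair (u (a + b), (1 - u) (a + b)) produced by the update, which is again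
   a pair of independent exponentials.  The generators are bounded, so A also
   intertwines the exponential series, and then all finite-dimensional
   expectations of observables of the temperature. *)

(** Temperatures are updated with weights that depend on the current energies, so [L_XT] does not
    preserve the functions of s alone. Identities are therefore proved for functions of the pair (x,
    s) and compared only after averaging over x. At a boundary edge the reset energy is a fresh
    exponential, so it forms with u (a + b) a pair of independent exponentials, again independent of
    the fraction. Independence of energies and temperatures comes out because the average of g(x)
    h(s) is a constant times h(s), and the opinion semigroup lets constants through. Two obstacles
    shape the details: [muX] is known only by its values on boxes, so the two energies of an edge
    are exposed by resampling them; and [Tbar] is a convex combination only when the two energies
    have nonzero sum, so integrands are compared at strictly positive energies. *)

Section density.
Context d (T : measurableType d) (R : realType).
Variables (mu m : {measure set T -> \bar R}) (p : T -> R).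
Hypotheses (mp : measurable_fun setT p) (p0 : forall x, 0 <= p x).
Hypothesis mE : forall A, measurable A -> m A = (\int[mu]_(x in A) (p x)%:E)%E.
Import HBNNSimple.
Local Open Scope ereal_scope.

(** On indicators this is the hypothesis [mE]; linearity gives simple functions, and monotone
    convergence along [nnsfun_approx] gives the rest. *)
Lemma ge0_integral_density (f : T -> \bar R) : measurable_fun setT f ->
  (forall x, 0 <= f x) -> \int[m]_x f x = \int[mu]_x ((p x)%:E * f x).
Proof.
move=> mf f0; pose g := nnsfun_approx measurableT mf.
have gf x : limn (fun k => (g k x)%:E) = f x.
  by apply/cvg_lim => //; exact: cvg_nnsfun_approx.
transitivity (limn (fun k => \int[m]_x (g k x)%:E)).
  rewrite -monotone_convergence//.
  - by apply: eq_integral => x _; rewrite gf.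
  - by move=> k; exact/measurable_EFinP/measurable_funTS.
  - by move=> k x _; rewrite lee_fin.
  - by move=> x _ i j ij; rewrite lee_fin; exact/lefP/nd_nnsfun_approx.
transitivity (limn (fun k => \int[mu]_x ((p x)%:E * (g k x)%:E))); last first.
  rewrite -monotone_convergence//.
  - apply: eq_integral => x _; rewrite limeMl ?gf//.
    exact: cvg_nnsfun_approx.
  - by move=> k; apply: emeasurable_funM; apply/measurable_EFinP => //;
      exact/measurable_funTS.
  - by move=> k x _; rewrite mule_ge0 ?lee_fin.
  - move=> x _ i j ij; rewrite lee_wpmul2l ?lee_fin//.
    exact/lefP/nd_nnsfun_approx.
congr (limn _); apply/funext => k.
under eq_integral do rewrite fimfunE -fsumEFin//.
rewrite ge0_integral_fsum//; last 2 first.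
  - by move=> r; exact/measurable_EFinP/measurable_funM.
  - by move=> r x _; rewrite EFinM nnfun_muleindic_ge0.
under [RHS]eq_integral.
  move=> x _; rewrite fimfunE -fsumEFin// ge0_mule_fsumr; last first.
    by move=> r; rewrite /= EFinM nnfun_muleindic_ge0.
  over.
rewrite [RHS]ge0_integral_fsum//; last 2 first.
  - move=> r; apply: emeasurable_funM; apply/measurable_EFinP => //.
    exact: measurable_funM.
  - move=> r x _; apply: mule_ge0; first by rewrite lee_fin.
    by rewrite EFinM nnfun_muleindic_ge0.
apply: eq_fsbigr => r _.
rewrite integralZl_indic_nnsfun// integral_indic// setIT.
under [RHS]eq_integral do rewrite EFinM muleCA.
have mr : measurable (g k @^-1` [set r]) by [].
(* The finite sum runs over all reals [r]; a negative [r] is not a value of [g k], so both sides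
   vanish there. *)
have [r0|r0] := ltP r 0%R.
  rewrite preimage_nnfun0// measure0 mule0 integral0_eq// => x _.
  by rewrite indicE in_set0 mulr0n !mule0.
rewrite [RHS]ge0_integralZl//; last 2 first.
  - by apply: emeasurable_funM; apply/measurable_EFinP => //; exact: measurable_indic.
  - by move=> x _; apply: mule_ge0; rewrite lee_fin.
congr (_ * _); rewrite mE// integral_mkcond; apply: eq_integral => x _.
by rewrite patchE indicE; case: ifP => _; rewrite ?mule1 ?mule0.
Qed.

(** Multiplication by the nonnegative [p] commutes with positive and negative parts. *)
Lemma integral_density (f : T -> \bar R) : measurable_fun setT f ->
  \int[m]_x f x = \int[mu]_x ((p x)%:E * f x).
Proof.
move=> mf; rewrite integralE [RHS]integralE; congr (_ - _).
  rewrite ge0_integral_density//; last exact: measurable_funepos.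
  apply: eq_integral => x _; rewrite !funeposE maxe_pMr ?lee_fin//.
  by rewrite mule0.
rewrite ge0_integral_density//; last exact: measurable_funeneg.
apply: eq_integral => x _; rewrite !funenegE maxe_pMr ?lee_fin//.
by rewrite mule0 muleN.
Qed.

End density.

(** * Translation and scaling of Lebesgue integrals *)

Section lebesgue_affine.
Context {R : realType}.
Notation mu := (@lebesgue_measure R).
Local Open Scope ereal_scope.

Lemma ge0_integral_shift (f : R -> \bar R) (c : R) : measurable_fun setT f ->
  (forall x, 0 <= f x) -> \int[mu]_x f (x + c)%R = \int[mu]_x f x.
Proof.
move=> mf f0.
have mphi : measurable_fun [set: measurableTypeR R]
    (fun x : measurableTypeR R => (x + c)%R : measurableTypeR R).
  exact: measurable_funD.
rewrite -[LHS](@ge0_integral_pushforward _ _ _ _ _ _ mphi mu setT f)//.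
apply: eq_measure_integral => A mA _; apply/esym/lebesgue_measure_unique => //.
move=> _ [[a b] _ <-].
have E : (fun x : measurableTypeR R => (x + c)%R : measurableTypeR R) @^-1` `]a, b] =
    `](a - c)%R, (b - c)%R]%classic.
  by apply/seteqP; split=> x /=; rewrite !in_itv/= ltrBlDr lerBrDr.
rewrite /= /pushforward E.
by rewrite !lebesgue_measure_itv/= !lte_fin ltrD2r -!EFinD opprB addrA subrK.
Qed.

Lemma ge0_integral_scale (f : R -> \bar R) (c : R) : (0 < c)%R ->
  measurable_fun setT f -> (forall x, 0 <= f x) ->
  c%:E * \int[mu]_x f (c * x)%R = \int[mu]_x f x.
Proof.
move=> c0 mf f0.
have mphi : measurable_fun [set: measurableTypeR R]
    (fun x : measurableTypeR R => (c * x)%R : measurableTypeR R).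
  exact: measurable_funM.
rewrite -[X in _ * X](@ge0_integral_pushforward _ _ _ _ _ _ mphi mu setT f)//.
rewrite -(@ge0_integral_mscale _ _ _ (pushforward mu _) setT measurableT (NngNum (ltW c0)))//.
apply: eq_measure_integral => A mA _; apply/esym/lebesgue_measure_unique => //.
move=> _ [[a b] _ <-].
have E : (fun x : measurableTypeR R => (c * x)%R : measurableTypeR R) @^-1` `]a, b] =
    `](a / c)%R, (b / c)%R]%classic.
  by apply/seteqP; split=> x /=; rewrite !in_itv/= ltr_pdivrMr// ler_pdivlMr// (mulrC x).
rewrite /= /mscale/= /pushforward E.
rewrite !lebesgue_measure_itv/= !lte_fin ltr_pM2r ?invr_gt0//.
case: ifPn => _; last by rewrite mule0.
by rewrite -!EFinD -EFinM mulrBr !(mulrC c) !divfK ?gt_eqF.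
Qed.

End lebesgue_affine.

(** * Sum and fraction of two independent exponentials *)

Section exponential_uniform.
Context {R : realType}.
Notation mu := (@lebesgue_measure R).

Definition exp_law : probability (measurableTypeR R) R :=
  exponential_distribution_exponential_prob__canonical__probability_measure_Probability
    (@ltr01 R).

Definition unif_law : probability (measurableTypeR R) R := uniform_prob (@ltr01 R).

(** Chosen to vanish at 0, where [exponential_pdf 1] equals 1, so that integrands need only be
    compared at strictly positive points. *)
Definition exp_density (x : R) : R := if 0 < x then expR (- x) else 0.

Definition unif_density (x : R) : R := if 0 <= x <= 1 then 1 else 0.

Lemma exp_density_ge0 x : 0 <= exp_density x.
Proof. by rewrite /exp_density; case: ifP => // _; exact: expR_ge0. Qed.

Lemma unif_density_ge0 x : 0 <= unif_density x.
Proof. by rewrite /unif_density; case: ifP. Qed.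

Lemma measurable_exp_density : measurable_fun [set: R] exp_density.
Proof.
apply: measurable_fun_if => //=; first exact: measurable_fun_ltr.
apply: measurable_funTS; apply: measurableT_comp; first exact: measurable_expR.
exact: measurable_funN.
Qed.

Lemma measurable_unif_density : measurable_fun [set: R] unif_density.
Proof.
apply: measurable_fun_if => //=.
by apply: measurable_and => //; exact: measurable_fun_ler.
Qed.

Local Open Scope ereal_scope.

Lemma ae_exponential_pdf (f : R -> \bar R) (A : set R) : measurable A ->
  measurable_fun setT f ->
  \int[mu]_(x in A) ((exponential_pdf 1%R x)%:E * f x) =
  \int[mu]_(x in A) ((exp_density x)%:E * f x).
Proof.
move=> mA mf; apply: ae_eq_integral => //.
- apply: measurable_funTS; apply: emeasurable_funM => //.
  by apply/measurable_EFinP; exact: measurable_exponential_pdf.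
- apply: measurable_funTS; apply: emeasurable_funM => //.
  by apply/measurable_EFinP; exact: measurable_exp_density.
- exists [set 0%R]; split => //; first exact: lebesgue_measure_set1.
  move=> x /= /not_implyP[_]; apply: contra_notP => /eqP x0.
  rewrite /exponential_pdf /exp_density patchE mem_setE/= in_itv/= andbT.
  by rewrite le_eqVlt eq_sym (negbTE x0)/= mul1r mulN1r.
Qed.

Lemma integral_exp_law (f : R -> \bar R) : measurable_fun setT f ->
  \int[exp_law]_x f x = \int[mu]_x ((exp_density x)%:E * f x).
Proof.
move=> mf; rewrite (@integral_density _ _ _ mu exp_law (exponential_pdf 1%R))//.
- exact: ae_exponential_pdf.
- exact: measurable_exponential_pdf.
- by move=> x; exact: exponential_pdf_ge0.
Qed.

Lemma integral_unif_law (f : R -> \bar R) : measurable_fun setT f ->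
  \int[unif_law]_x f x = \int[mu]_x ((unif_density x)%:E * f x).
Proof.
move=> mf; rewrite (@integral_density _ _ _ mu unif_law unif_density)//.
- exact: measurable_unif_density.
- exact: unif_density_ge0.
- move=> A mA; rewrite /= /uniform_prob; apply: eq_integral => x _.
  by rewrite /uniform_pdf /unif_density subr0 invr1.
Qed.

(** Density of the Gamma(2, 1) law, that of the sum of two independent exponentials of mean 1. *)
Definition gamma2_density (s : R) : R := (if 0 < s then s * expR (- s) else 0)%R.

Lemma measurable_curry1 (K : R * R -> \bar R) : measurable_fun setT K ->
  forall a, measurable_fun setT (fun b => K (a, b)).
Proof. by move=> mK a; apply: measurableT_comp => //; exact: measurable_pair1. Qed.

Lemma measurable_inv : measurable_fun [set: R] (fun x : R => x^-1%R).
Proof.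
have -> : [set: R] = [set 0%R] `|` ~` [set 0%R] by rewrite setUv.
apply/measurable_funU => //; first exact: measurableC.
split; first exact: measurable_fun_set1.
apply: open_continuous_measurable_fun; first exact/closed_openC/closed_eq.
by move=> x; rewrite inE/= => /eqP x0; exact: (@inv_continuous R x x0).
Qed.

Lemma measurable_div : measurable_fun [set: R * R] (fun z : R * R => (z.1 / z.2)%R).
Proof.
by apply: measurable_funM => //; exact: (measurableT_comp measurable_inv).
Qed.

(* Substituting s = a + b and then a = s v. *)
Lemma exp_law_pair (K : R * R -> \bar R) : measurable_fun setT K ->
  (forall z, 0 <= K z) ->
  \int[exp_law]_a \int[exp_law]_b K (a + b, a / (a + b))%R =
  \int[mu]_s ((gamma2_density s)%:E * \int[unif_law]_v K (s, v)).
Proof.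
move=> mK K0; pose q := exp_density.
have mq : measurable_fun [set: R] q := measurable_exp_density.
have q0 x : (0 <= q x)%R := exp_density_ge0 x.
have mKsum : measurable_fun setT (fun z : R * R => K (z.1 + z.2, z.1 / (z.1 + z.2))%R).
  apply: measurableT_comp => //; apply: measurable_fun_pair => /=.
    exact: measurable_funD.
  apply: (measurableT_comp measurable_div (g := fun z : R * R => (z.1, z.1 + z.2)%R)).
  by apply: measurable_fun_pair => //; exact: measurable_funD.
(* The integrand in the variables (a, s), including the joint density of [a] and [a + b]. *)
pose F (z : R * R) := (q z.1)%:E * ((q (z.2 - z.1)%R)%:E * K (z.2, z.1 / z.2)%R).
have mF : measurable_fun setT F.
  apply: emeasurable_funM; first by apply/measurable_EFinP; apply: measurableT_comp.
  apply: emeasurable_funM.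
    by apply/measurable_EFinP; apply: measurableT_comp => //; exact: measurable_funB.
  apply: measurableT_comp => //; apply: measurable_fun_pair => //=.
  exact: measurable_div.
have F0 z : 0 <= F z by rewrite !mule_ge0// lee_fin.
transitivity (\int[mu]_a \int[mu]_s F (a, s)).
  rewrite integral_exp_law; last first.
    apply: (measurable_fun_fubini_tonelli_F (m2 := exp_law)
      (fun z : R * R => K (z.1 + z.2, z.1 / (z.1 + z.2))%R)) => //.
  apply: eq_integral => a _.
  rewrite integral_exp_law; last exact: (measurable_curry1 mKsum).
  pose g b := (q b)%:E * K (a + b, a / (a + b))%R.
  have mg : measurable_fun setT g.
    apply: emeasurable_funM; first exact/measurable_EFinP.
    exact: (measurable_curry1 mKsum).
  have g0 x : 0 <= g x by rewrite mule_ge0// lee_fin.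
  have mgs : measurable_fun setT (fun x : R => g (x - a)%R).
    by apply: measurableT_comp => //; exact: measurable_funB.
  transitivity ((q a)%:E * \int[mu]_s g (s - a)%R).
    by rewrite (ge0_integral_shift (- a)%R mg).
  rewrite -ge0_integralZl//; last by rewrite lee_fin.
  by apply: eq_integral => s _; rewrite /F/g/= subrKC.
transitivity (\int[mu]_s \int[mu]_a F (a, s)).
  exact: (fubini_tonelli (m1 := mu) (m2 := mu) F).
apply: eq_integral => s _.
rewrite integral_unif_law; last exact: measurable_curry1.
(* The density in [F] forces 0 < a < s, which is impossible when s is not positive. *)
rewrite /gamma2_density; case: ifPn => [s0|s0]; last first.
  rewrite mul0e integral0_eq// => a _; rewrite /F/= /q /exp_density.
  case: ifPn => [a0|_]; last by rewrite mul0e.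
  by rewrite subr_gt0 ifN ?mul0e ?mule0//; apply: contra s0; exact: lt_trans.
have mh : measurable_fun setT (fun v : R => (unif_density v)%:E * K (s, v)).
  apply: emeasurable_funM; last exact: measurable_curry1.
  by apply/measurable_EFinP; exact: measurable_unif_density.
have mFs : measurable_fun setT (fun a : R => F (a, s)).
  by apply: measurableT_comp => //; exact: measurable_pair2.
(* The Jacobian of a = s v is the factor s of [gamma2_density]. *)
rewrite -(ge0_integral_scale s0 mFs)// EFinM -muleA; congr (_ * _).
rewrite -ge0_integralZl//; last first.
  by move=> x _; rewrite mule_ge0// lee_fin; exact: unif_density_ge0.
apply: ae_eq_integral => //.
- apply: (measurableT_comp mFs (g := fun x : R => (s * x)%R)).
  exact: mulrl_measurable.
- exact: emeasurable_funM.
(* The exponential densities require 0 < v < 1, while [unif_density] is 1 on the closed interval;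
   the endpoints form a null set. *)
exists ([set 0%R] `|` [set 1%R]); split.
- exact: measurableU.
- by rewrite measureU0//; exact: lebesgue_measure_set1.
move=> v /= /not_implyP[_]; apply: contra_notP => /not_orP[/eqP v0 /eqP v1].
rewrite /F/= /q/exp_density/unif_density pmulr_rgt0// subr_gt0 gtr_pMr//.
rewrite !le_eqVlt eq_sym (negbTE v0) (negbTE v1)/=.
case: (ltP 0%R v) => [v0'|]; last by rewrite !mul0e mule0.
case: (ltP v 1%R) => [v1'|]; last by rewrite !mul0e !mule0.
rewrite mul1e muleA -EFinM -expRD; congr (_ * _)%E.
  by congr (expR _)%:E; ring.
by congr (K (_, _)); field; rewrite gt_eqF.
Qed.

End exponential_uniform.

Section canonical_measurable_structure.
Context {R : realType} (P : probability (measurableTypeR R) R).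

(* [measurableTypeR R] and [R] carry the same sigma-algebra but are distinct
   measurable types; tuples are built on the latter. *)
Definition on_real : set R -> \bar R := P.

HB.instance Definition _ := isMeasure.Build _ R R on_real
  (measure0 P) (measure_ge0 P) (@measure_semi_sigma_additive _ _ _ P).

HB.instance Definition _ := Measure_isProbability.Build _ R R on_real
  (probability_setT P).

Lemma integral_on_real (f : R -> \bar R) : measurable_fun setT f ->
  (\int[on_real]_x f x = \int[P]_x f x)%E.
Proof.
have mid : measurable_fun [set: measurableTypeR R] (id : measurableTypeR R -> R).
  exact: measurable_id.
have ge0 (g : R -> \bar R) : measurable_fun setT g -> (forall x, 0 <= g x)%E ->
    (\int[on_real]_x g x = \int[P]_x g x)%E.
  move=> mg g0.
  by rewrite -[RHS](@ge0_integral_pushforward _ _ _ _ _ _ mid P setT g)//.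
move=> mf; rewrite integralE [RHS]integralE; congr (_ - _)%E; apply: ge0 => //.
- exact: measurable_funepos.
- exact: measurable_funeneg.
Qed.

End canonical_measurable_structure.

Definition exp1 {R : realType} : probability R R := on_real exp_law.

Definition unif {R : realType} : probability R R := on_real unif_law.

Section exponential_uniform_on_real.
Context {R : realType}.
Local Open Scope ereal_scope.

Lemma integral_exp1 (f : R -> \bar R) : measurable_fun setT f ->
  \int[exp1]_x f x = \int[@lebesgue_measure R]_x ((exp_density x)%:E * f x).
Proof. by move=> mf; rewrite integral_on_real// integral_exp_law. Qed.

Lemma integral_unif (f : R -> \bar R) : measurable_fun setT f ->
  \int[unif]_x f x = \int[@lebesgue_measure R]_x ((unif_density x)%:E * f x).
Proof. by move=> mf; rewrite integral_on_real// integral_unif_law. Qed.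

Lemma eq_exp1 (f g : R -> \bar R) :
  measurable_fun setT f -> measurable_fun setT g ->
  (forall x, (0 < x)%R -> f x = g x) -> \int[exp1]_x f x = \int[exp1]_x g x.
Proof.
move=> mf mg fg; rewrite !integral_exp1//; apply: eq_integral => x _.
by rewrite /exp_density; case: ifPn => [/fg->//|_]; rewrite !mul0e.
Qed.

Lemma exp1_pair (K : R * R -> \bar R) : measurable_fun setT K ->
  (forall z, 0 <= K z) ->
  \int[exp1]_a \int[exp1]_b K (a + b, a / (a + b))%R =
  \int[@lebesgue_measure R]_s ((gamma2_density s)%:E * \int[unif]_v K (s, v)).
Proof.
move=> mK K0; pose K' (z : R * R) := K (z.1 + z.2, z.1 / (z.1 + z.2))%R.
have mK' : measurable_fun setT K'.
  apply: measurableT_comp => //; apply: measurable_fun_pair => /=.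
    exact: measurable_funD.
  apply: (measurableT_comp measurable_div (g := fun z : R * R => (z.1, z.1 + z.2)%R)).
  by apply: measurable_fun_pair => //; exact: measurable_funD.
rewrite integral_on_real; last first.
  by apply: (measurable_fun_fubini_tonelli_F (m2 := exp1) K') => // z; exact: K0.
under eq_integral do rewrite (integral_on_real _ (measurable_curry1 mK' _)).
under [RHS]eq_integral do rewrite (integral_on_real _ (measurable_curry1 mK _)).
exact: exp_law_pair.
Qed.

End exponential_uniform_on_real.

(** Keeps the bound explicit, unlike [bounded_meas], so that the growth of iterated generators can
    be tracked and the exponential series majorised. *)
Definition bmeas d (U : measurableType d) (R : realType) (M : R) (f : U -> R) :=
  measurable_fun [set: U] f /\ forall z, `|f z| <= M.

(** * Expectations of bounded measurable functions *)

Section bounded_integrals.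
Context d (T : measurableType d) (R : realType) (m : probability T R).
Implicit Types (f g : T -> R) (M c : R).

Lemma bmeas_integrable M f : bmeas M f -> m.-integrable setT (EFin \o f).
Proof.
move=> [mf fM]; apply: (@le_integrable _ _ _ m setT measurableT _ (EFin \o cst M)).
- exact/measurable_EFinP.
- by move=> x _ /=; rewrite lee_fin (le_trans (fM x))// ler_norm.
- exact: finite_measure_integrable_cst.
Qed.

Lemma EFin_Eint M f : bmeas M f -> (Eint m f)%:E = (\int[m]_x (f x)%:E)%E.
Proof.
by move=> /bmeas_integrable fi; rewrite /Eint fineK//; exact: integrable_fin_num.
Qed.

Lemma eq_Eint f g : (forall x, f x = g x) -> Eint m f = Eint m g.
Proof. by move=> /funext ->. Qed.

Lemma Eint_cst c : Eint m (fun=> c) = c.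
Proof. by rewrite /Eint integral_cst//= [m _]probability_setT mule1. Qed.

Lemma EintD M N f g : bmeas M f -> bmeas N g ->
  Eint m (fun x => f x + g x) = Eint m f + Eint m g.
Proof.
move=> /bmeas_integrable fi /bmeas_integrable gi.
exact: (@RintegralD _ _ _ m setT).
Qed.

Lemma EintB M N f g : bmeas M f -> bmeas N g ->
  Eint m (fun x => f x - g x) = Eint m f - Eint m g.
Proof.
move=> /bmeas_integrable fi /bmeas_integrable gi.
exact: (@RintegralB _ _ _ m setT).
Qed.

Lemma EintZ M c f : bmeas M f -> Eint m (fun x => c * f x) = c * Eint m f.
Proof.
by move=> /bmeas_integrable fi; exact: (@RintegralZl _ _ _ m setT).
Qed.

Lemma norm_Eint_le M f : bmeas M f -> `|Eint m f| <= M.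
Proof.
move=> fM; have fi := bmeas_integrable fM.
rewrite (le_trans (@le_normr_Rintegral _ _ _ m setT f measurableT fi))//.
rewrite -[leRHS]Eint_cst.
apply: (@le_Rintegral _ _ _ m setT) => //.
- exact: (integrable_norm fi).
- exact: finite_measure_integrable_cst.
- by move=> x _; exact: fM.2.
Qed.

Lemma bmeas_cst c : bmeas `|c| (fun _ : T => c).
Proof. by split. Qed.

Lemma bmeasD M N f g : bmeas M f -> bmeas N g -> bmeas (M + N) (fun x => f x + g x).
Proof.
move=> [mf fM] [mg gN]; split; first exact: measurable_funD.
by move=> x; rewrite (le_trans (ler_normD _ _))// lerD.
Qed.

Lemma bmeasB M N f g : bmeas M f -> bmeas N g -> bmeas (M + N) (fun x => f x - g x).
Proof.
move=> [mf fM] [mg gN]; split; first exact: measurable_funB.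
by move=> x; rewrite (le_trans (ler_normB _ _))// lerD.
Qed.

Lemma bmeasM M N f g : bmeas M f -> bmeas N g -> bmeas (M * N) (fun x => f x * g x).
Proof.
move=> [mf fM] [mg gN]; split; first exact: measurable_funM.
by move=> x; rewrite normrM ler_pM.
Qed.

Lemma bmeasZ M c f : bmeas M f -> bmeas (`|c| * M) (fun x => c * f x).
Proof. exact: (bmeasM (bmeas_cst c)). Qed.

Lemma bmeas_comp d' (U : measurableType d') (phi : U -> T) M f :
  bmeas M f -> measurable_fun setT phi -> bmeas M (fun x => f (phi x)).
Proof. by move=> [mf fM] mphi; split=> [|x//]; exact: measurableT_comp. Qed.

Lemma bmeas_sum (I : Type) (r : seq I) (P : pred I) (F : I -> T -> R) (B : I -> R) :
  (forall i, P i -> bmeas (B i) (F i)) ->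
  bmeas (\sum_(i <- r | P i) B i) (fun x => \sum_(i <- r | P i) F i x).
Proof.
move=> FB; elim: r => [|i r IH].
  rewrite big_nil (_ : (fun x => _) = fun=> 0); last first.
    by apply/funext => x; rewrite big_nil.
  by rewrite -[X in bmeas X](@normr0 _ R); exact: bmeas_cst.
rewrite big_cons (_ : (fun x => _) = fun x =>
    if P i then F i x + \sum_(j <- r | P j) F j x else \sum_(j <- r | P j) F j x).
  by case: ifP => // Pi; apply: bmeasD => //; exact: FB.
by apply/funext => x; rewrite big_cons.
Qed.

Lemma Eint_sum (I : Type) (r : seq I) (P : pred I) (F : I -> T -> R) (B : I -> R) :
  (forall i, P i -> bmeas (B i) (F i)) ->
  Eint m (fun x => \sum_(i <- r | P i) F i x) = \sum_(i <- r | P i) Eint m (F i).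
Proof.
move=> FB; elim: r => [|i r IH].
  rewrite big_nil -[RHS](Eint_cst 0); congr Eint.
  by apply/funext => x; rewrite big_nil.
rewrite big_cons -IH (_ : (fun x => _) = fun x =>
    if P i then F i x + \sum_(j <- r | P j) F j x else \sum_(j <- r | P j) F j x).
  case: ifP => // Pi; apply: EintD; first exact: FB.
  exact: (bmeas_sum r FB).
by apply/funext => x; rewrite big_cons.
Qed.

End bounded_integrals.

Section parametric_integrals.
Context d1 d2 (T1 : measurableType d1) (T2 : measurableType d2) (R : realType).

Lemma bmeas_Eint (m : probability T2 R) M (f : T1 * T2 -> R) : bmeas M f ->
  bmeas M (fun x => Eint m (fun y => f (x, y))).
Proof.
move=> fM; have fxM x : bmeas M (fun y => f (x, y)).
  by apply: (bmeas_comp fM); exact: measurable_pair1.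
split=> [|x]; last exact: norm_Eint_le.
(* Adding the bound makes the integrand nonnegative, so that the measurability part of Tonelli
   applies. *)
pose g z := f z + M; have [mg _] := bmeasD fM (bmeas_cst _ M).
have g0 z : 0 <= g z by have := fM.2 z; rewrite ler_norml /g -lerBlDr sub0r => /andP[].
rewrite (_ : (fun x => _) =
    (fun x => fine (\int[m]_y (g (x, y))%:E)%E - M)); last first.
  apply/funext => x; rewrite -[fine _]/(Eint m (fun y => g (x, y))).
  by rewrite (EintD m (fxM x) (bmeas_cst _ M)) Eint_cst addrK.
apply: measurable_funB => //; apply: measurableT_comp => //.
apply: (measurable_fun_fubini_tonelli_F (m2 := m) (fun z => (g z)%:E)) => //.
by apply/measurable_EFinP.
Qed.

End parametric_integrals.

Section iterated_integrals.
Context d1 d2 (T1 : measurableType d1) (T2 : measurableType d2) (R : realType).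

Lemma Eint_swap (m1 : probability T1 R) (m2 : probability T2 R) M
    (f : T1 -> T2 -> R) : bmeas M (fun z => f z.1 z.2) ->
  Eint m1 (fun x => Eint m2 (fun y => f x y)) =
  Eint m2 (fun y => Eint m1 (fun x => f x y)).
Proof.
move=> fM; apply: EFin_inj.
rewrite (EFin_Eint _ (bmeas_Eint m2 fM)).
rewrite (EFin_Eint _ (bmeas_Eint m1 (bmeas_comp fM (measurable_swap (T1 := T2) (T2 := T1))))).
have fx x : bmeas M (f x).
  by apply: (bmeas_comp fM (phi := fun y => (x, y))); exact: measurable_pair1.
have fy y : bmeas M (f ^~ y).
  by apply: (bmeas_comp fM (phi := fun x => (x, y))); exact: measurable_pair2.
under eq_integral do rewrite (EFin_Eint _ (fx _)).
rewrite (Fubini (bmeas_integrable (m1 \x m2)%E fM)).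
by apply: eq_integral => y _; rewrite (EFin_Eint _ (fy y)).
Qed.

Lemma Eint_prod (m1 : probability T1 R) (m2 : probability T2 R) M (f : T1 * T2 -> R) :
  bmeas M f ->
  Eint (m1 \x m2)%E f = Eint m1 (fun x => Eint m2 (fun y => f (x, y))).
Proof.
move=> fM; apply: EFin_inj; rewrite (EFin_Eint _ fM) (EFin_Eint _ (bmeas_Eint m2 fM)).
rewrite -(integral12_prod_meas1 (bmeas_integrable (m1 \x m2)%E fM)).
apply: eq_integral => x _; rewrite (EFin_Eint _ (M := M))//.
by apply: (bmeas_comp fM); exact: measurable_pair1.
Qed.

End iterated_integrals.

Ltac solve_measurable := repeat first
  [ exact: measurable_cst | exact: measurable_id | assumption
  | exact: measurable_fst | exact: measurable_snd
  | apply: measurable_fun_pair | apply: measurable_funD | apply: measurable_funN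
  | apply: measurable_funM | apply: (measurableT_comp measurable_inv)
  | apply: (measurableT_comp measurable_fst)
  | apply: (measurableT_comp measurable_snd) ].

(** * The exchange identities behind one edge update *)

Section exponential_splitting.
Context {R : realType}.

(** Stated in [\bar R] because the outer integral on the right is against Lebesgue measure, outside
    the calculus of [Eint] for probabilities. *)
Lemma Eint_exp1_pair M (K : R * R -> R) : bmeas M K -> (forall z, 0 <= K z) ->
  (Eint exp1 (fun a => Eint exp1 (fun b => K (a + b, a / (a + b)))))%:E =
  (\int[@lebesgue_measure R]_s
     ((gamma2_density s)%:E * (Eint unif (fun v => K (s, v)))%:E))%E.
Proof.
move=> KM K0.
pose K' (z : R * R) := K (z.1 + z.2, z.1 / (z.1 + z.2)).
have K'M : bmeas M K' by apply: (bmeas_comp KM); solve_measurable.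
have fK (s : R) : bmeas M (fun v : R => K (s, v)).
  by apply: (bmeas_comp KM); solve_measurable.
have fK' (s : R) : bmeas M (fun v : R => K' (s, v)).
  by apply: (bmeas_comp K'M); solve_measurable.
rewrite (EFin_Eint _ (bmeas_Eint exp1 K'M)).
under eq_integral do rewrite (EFin_Eint _ (fK' _)).
rewrite (exp1_pair (K := EFin \o K))/=.
- by apply: eq_integral => s _; rewrite (EFin_Eint _ (fK s)).
- by apply/measurable_EFinP; exact: KM.1.
- by move=> z; rewrite lee_fin.
Qed.

Lemma eq_Eint_exp1 M N (f g : R -> R) : bmeas M f -> bmeas N g ->
  (forall x, 0 < x -> f x = g x) -> Eint exp1 f = Eint exp1 g.
Proof.
move=> [mf _] [mg _] fg; congr fine; apply: eq_exp1.
- exact/measurable_EFinP.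
- exact/measurable_EFinP.
- by move=> x x0; rewrite fg.
Qed.

(** In the variables s = a + b and v = a / (a + b), the left side averages G(u s, (1 - u) s, v) and
    the right side G(v s, (1 - v) s, u), with [u] and [v] independent uniforms. The identity is the
    exchange of these two uniforms. *)
Lemma exp1_split_ge0 M (G : R * R * R -> R) : bmeas M G -> (forall z, 0 <= G z) ->
  Eint exp1 (fun a => Eint exp1 (fun b => Eint unif (fun u =>
    G (u * (a + b), (1 - u) * (a + b), a / (a + b))))) =
  Eint exp1 (fun a => Eint exp1 (fun b => Eint unif (fun v => G (a, b, v)))).
Proof.
move=> GM G0.
pose H (z : R * R * R) := G (z.2 * z.1.1, (1 - z.2) * z.1.1, z.1.2).
have HM : bmeas M H by apply: (bmeas_comp GM); solve_measurable.
pose H' (z : R * R * R) := G (z.1.2 * z.1.1, (1 - z.1.2) * z.1.1, z.2).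
have H'M : bmeas M H' by apply: (bmeas_comp GM); solve_measurable.
have EintG0 (f : R -> R) : (forall x, 0 <= f x) -> 0 <= Eint unif f.
  by move=> f0; rewrite fine_ge0// integral_ge0// => x _; rewrite lee_fin.
pose K1 z := Eint unif (fun u => H (z, u)).
pose K2 z := Eint unif (fun v => H' (z, v)).
have K1M : bmeas M K1 := bmeas_Eint unif HM.
have K2M : bmeas M K2 := bmeas_Eint unif H'M.
transitivity (Eint exp1 (fun a => Eint exp1 (fun b => K2 (a + b, a / (a + b))))).
  transitivity (Eint exp1 (fun a => Eint exp1 (fun b => K1 (a + b, a / (a + b))))).
    by [].
  apply: EFin_inj.
  rewrite [LHS](Eint_exp1_pair K1M); last by move=> z; apply: EintG0 => x; exact: G0.
  rewrite [RHS](Eint_exp1_pair K2M); last by move=> z; apply: EintG0 => x; exact: G0.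
  apply: eq_integral => s _; congr (_ * _%:E)%E.
  apply: (Eint_swap _ _ (M := M) (f := fun v u => H (s, v, u))).
  by apply: (bmeas_comp HM (phi := fun z : R * R => (s, z.1, z.2))); solve_measurable.
pose J (z : R * R * R) := H' (z.1.1 + z.1.2, z.1.1 / (z.1.1 + z.1.2), z.2).
have JM : bmeas M J by apply: (bmeas_comp H'M); solve_measurable.
have J2M := bmeas_Eint unif JM.
have G2M := bmeas_Eint unif GM.
(* At positive energies the sum times the fraction gives back [a], and the remainder [b]. *)
apply: (eq_Eint_exp1 (bmeas_Eint exp1 J2M) (bmeas_Eint exp1 G2M)) => a a0.
apply: (@eq_Eint_exp1 M M) => [| |b b0].
- by apply: (bmeas_comp J2M); solve_measurable.
- by apply: (bmeas_comp G2M); solve_measurable.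
apply: eq_Eint => v; rewrite /J/H'/=.
have ab : a + b != 0 by rewrite gt_eqF// addr_gt0.
by congr (G (_, _, _)); field.
Qed.

(** Adding the bound [M] makes [G] nonnegative and shifts both sides by [M], all the laws being
    probabilities. *)
Lemma exp1_split M (G : R * R * R -> R) : bmeas M G ->
  Eint exp1 (fun a => Eint exp1 (fun b => Eint unif (fun u =>
    G (u * (a + b), (1 - u) * (a + b), a / (a + b))))) =
  Eint exp1 (fun a => Eint exp1 (fun b => Eint unif (fun v => G (a, b, v)))).
Proof.
move=> GM; have GcM := bmeasD GM (bmeas_cst _ M).
pose E3 (H : R * R * R -> R) :=
  Eint exp1 (fun a => Eint exp1 (fun b => Eint unif (fun u => H (a, b, u)))).
have E3D H : bmeas M H -> E3 (fun z => H z + M) = E3 H + M.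
  move=> HM; have H2M := bmeas_Eint unif HM; have H1M := bmeas_Eint exp1 H2M.
  rewrite /E3 -[X in _ + X](Eint_cst exp1 M) -(EintD _ H1M (bmeas_cst _ M)).
  apply: eq_Eint => a.
  rewrite -[X in _ + X](Eint_cst exp1 M) -(EintD _ (M := M) _ (bmeas_cst _ M)).
    apply: eq_Eint => b.
    rewrite (EintD _ (M := M) _ (bmeas_cst _ M)) ?Eint_cst//.
    by apply: (bmeas_comp HM); solve_measurable.
  by apply: (bmeas_comp H2M); solve_measurable.
pose G' (z : R * R * R) := G (z.2 * (z.1.1 + z.1.2), (1 - z.2) * (z.1.1 + z.1.2),
  z.1.1 / (z.1.1 + z.1.2)).
have G'M : bmeas M G' by apply: (bmeas_comp GM); solve_measurable.
apply: (addIr M); rewrite -[LHS](E3D G' G'M) -[RHS](E3D G GM).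
apply: (exp1_split_ge0 GcM) => z.
by have := GM.2 z; rewrite ler_norml -lerBlDr sub0r => /andP[].
Qed.

(** For fixed [c], [exp1_split] applied to a function blind to its second argument turns
    [u * (a + b)] and the fraction into an exponential and an independent uniform; [c] then takes
    the place of the second exponential. *)
Lemma exp1_split_reset M (G : R * R * R -> R) : bmeas M G ->
  Eint exp1 (fun a => Eint exp1 (fun b => Eint exp1 (fun c => Eint unif (fun u =>
    G (u * (a + b), c, a / (a + b)))))) =
  Eint exp1 (fun a => Eint exp1 (fun b => Eint unif (fun v => G (a, b, v)))).
Proof.
move=> GM.
(* the fresh exponential c is moved outside, where [exp1_split] applies *)
pose H (z : R * R * R * R) :=
  G (z.2 * (z.1.1.1 + z.1.1.2), z.1.2, z.1.1.1 / (z.1.1.1 + z.1.1.2)).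
have HM : bmeas M H by apply: (bmeas_comp GM); solve_measurable.
pose H3 z := Eint unif (fun u => H (z, u)).
have H3M : bmeas M H3 := bmeas_Eint unif HM.
pose G2 z := Eint unif (fun v => G (z, v)).
have G2M : bmeas M G2 := bmeas_Eint unif GM.
transitivity (Eint exp1 (fun a => Eint exp1 (fun b => Eint exp1 (fun c => H3 (a, b, c))))).
  by [].
transitivity (Eint exp1 (fun a => Eint exp1 (fun c => Eint exp1 (fun b => H3 (a, b, c))))).
  apply: eq_Eint => a; apply: (Eint_swap _ _ (M := M) (f := fun b c => H3 (a, b, c))).
  by apply: (bmeas_comp H3M (phi := fun z : R * R => (a, z.1, z.2))); solve_measurable.
transitivity (Eint exp1 (fun c => Eint exp1 (fun a => Eint exp1 (fun b => H3 (a, b, c))))).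
  apply: (Eint_swap _ _ (M := M) (f := fun a c => Eint exp1 (fun b => H3 (a, b, c)))).
  apply: (bmeas_Eint exp1 (f := fun z : R * R * R => H3 (z.1.1, z.2, z.1.2))).
  by apply: (bmeas_comp H3M (phi := fun z : R * R * R => (z.1.1, z.2, z.1.2)));
    solve_measurable.
transitivity (Eint exp1 (fun c => Eint exp1 (fun a => Eint exp1 (fun b : R => G2 (a, c))))).
  apply: eq_Eint => c.
  apply: (exp1_split (M := M) (G := fun z => G (z.1.1, c, z.2))).
  by apply: (bmeas_comp GM (phi := fun z : R * R * R => (z.1.1, c, z.2))); solve_measurable.
transitivity (Eint exp1 (fun c => Eint exp1 (fun a => G2 (a, c)))).
  by apply: eq_Eint => c; apply: eq_Eint => a; exact: Eint_cst.
apply: (Eint_swap _ _ (M := M) (f := fun c a => G2 (a, c))).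
by apply: (bmeas_comp G2M (phi := fun z : R * R => (z.2, z.1))); solve_measurable.
Qed.

End exponential_splitting.

Section update.
Context {R : realType} {n : nat}.
Implicit Types (x : n.-tuple R) (i j k : 'I_n).

Lemma tnth_upd2 x i j a b k :
  tnth (upd2 x i j a b) k = if k == i then a else if k == j then b else tnth x k.
Proof. by rewrite tnth_mktuple. Qed.

Lemma upd2_upd2 x i j a b c d' : upd2 (upd2 x i j a b) i j c d' = upd2 x i j c d'.
Proof.
apply: eq_from_tnth => k; rewrite !tnth_upd2.
by case: ifP => // ->; case: ifP => // ->.
Qed.

Lemma measurable_upd2 d (T : measurableType d) (f : T -> n.-tuple R) (g h : T -> R) i j :
  measurable_fun setT f -> measurable_fun setT g -> measurable_fun setT h ->
  measurable_fun setT (fun z => upd2 (f z) i j (g z) (h z)).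
Proof.
move=> mf mg mh; apply/measurable_fun_tnthP => k.
rewrite (_ : _ \o _ = fun z => if k == i then g z else if k == j then h z
  else tnth (f z) k); last by apply/funext => z /=; rewrite tnth_upd2.
case: eqP => // _; case: eqP => // _.
exact: (measurableT_comp (measurable_tnth k) mf).
Qed.

End update.

(** * Resampling two coordinates of the product law *)

Section resampling.
Context {R : realType} {n : nat}.

Definition box (A : 'I_n -> set R) : set (n.-tuple R) :=
  [set x | forall i, A i (tnth x i)].

Definition boxes : set (set (n.-tuple R)) :=
  [set B | exists2 A, forall i, measurable (A i) & box A = B].

Lemma boxT : box (fun=> setT) = setT.
Proof. by apply/seteqP; split. Qed.

Lemma measurable_box A : (forall i, measurable (A i)) -> measurable (box A).
Proof.
move=> mA; rewrite (_ : box A = \bigcap_(i in setT) ((@tnth n R)^~ i @^-1` A i)).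
  apply: fin_bigcap_measurable => // i _; rewrite -[X in measurable X]setTI.
  exact: measurable_tnth.
by apply/seteqP; split=> x xA i => [_|]; exact: xA.
Qed.

(** A coordinate cylinder is a box whose other sides are full, and a box is a finite intersection of
    cylinders. *)
Lemma measurable_boxesE : @measurable _ (n.-tuple R) = <<s boxes >>.
Proof.
apply/seteqP; split.
- apply: smallest_sub; first exact: smallest_sigma_algebra.
  rewrite -bigcup_seq => B [i /= _] [A mA <-]; apply: sub_sigma_algebra.
  exists (fun k => if k == i then A else setT) => [k|]; first by case: ifP.
  apply/seteqP; split=> x /=.
    by move=> /(_ i); rewrite eqxx => Ax; split.
  by move=> [_ Ax] k; case: ifPn => // /eqP ->.
- apply: smallest_sub; first exact: sigma_algebra_measurable.
  by move=> _ [A mA <-]; exact: measurable_box.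
Qed.

Lemma setI_closed_boxes : setI_closed boxes.
Proof.
move=> _ _ [A mA <-] [B mB <-]; exists (fun i => A i `&` B i) => [i|].
  exact: measurableI.
by apply/seteqP; split=> x /= => [H|[HA HB] i]; split=> // i; have [] := H i.
Qed.

(** Overwriting coordinates [i] and [j] by fresh exponentials preserves the mass of every box, hence
    the law, since boxes form a generating pi-system. This yields two explicit exponentials without
    factoring the tuple space. *)
Lemma is_prod_exp1_resample (m : probability (n.-tuple R) R) (i j : 'I_n) M
    (F : n.-tuple R -> R) : is_prod_exp1 m -> i != j -> bmeas M F ->
  Eint m F = Eint m (fun x => Eint exp1 (fun a => Eint exp1 (fun b =>
    F (upd2 x i j a b)))).
Proof.
move=> mexp ij FM; pose phi (z : n.-tuple R * (R * R)) := upd2 z.1 i j z.2.1 z.2.2.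
have mphi : measurable_fun setT phi by apply: measurable_upd2; solve_measurable.
pose E2 : probability (R * R)%type R := (@exp1 R \x @exp1 R)%E.
pose P : probability (n.-tuple R * (R * R))%type R := (m \x E2)%E.
have boxE A : (forall k, measurable (A k)) -> m (box A) = pushforward P phi (box A).
  (* The old values at [i] and [j] are overwritten, so the preimage of a box leaves them
     unconstrained. *)
  move=> mA; pose A' k := if (k == i) || (k == j) then setT else A k.
  have mA' k : measurable (A' k) by rewrite /A'; case: ifP.
  rewrite /pushforward (_ : phi @^-1` box A = box A' `*` (A i `*` A j)).
    have -> : P (box A' `*` (A i `*` A j)) = (m (box A') * (exp1 (A i) * exp1 (A j)))%E.
      have mAij := measurableX (mA i) (mA j).
      apply: (etrans (product_measure1E m E2 (measurable_box mA') mAij)).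
      by congr (_ * _)%E; exact: (product_measure1E (@exp1 R) (@exp1 R) (mA i) (mA j)).
    rewrite [LHS]mexp// [X in (X * _)%E]mexp//.
    rewrite (bigD1 i)//= (bigD1 j) 1?eq_sym//= [in RHS](bigD1 i)//= [in RHS](bigD1 j) 1?eq_sym//=.
    rewrite /A' !eqxx orbT/=.
    rewrite [exponential_prob 1 setT](@probability_setT _ _ _ (@exp1 R)) !mul1e.
    rewrite muleA muleC; congr (_ * _)%E.
    by apply: eq_bigr => k /andP[/negbTE -> /negbTE ->].
  apply/seteqP; split=> z /=; rewrite /box /phi /=.
    move=> H; split=> [k|]; first rewrite /A'.
      by case: ifPn => //; rewrite negb_or => /andP[/negbTE ki /negbTE kj];
        have := H k; rewrite tnth_upd2 ki kj.
    by split; [have := H i | have := H j]; rewrite tnth_upd2 eqxx// eq_sym (negbTE ij).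
  move=> [HA [Ai Aj]] k; rewrite tnth_upd2; have := HA k; rewrite /A'.
  by case: eqP => [->//|_]; case: eqP => [->|].
have mP A : measurable A -> m A = pushforward P phi A.
  move=> mA; apply: (measure_unique boxes (fun=> setT)) => //.
  - exact: measurable_boxesE.
  - exact: setI_closed_boxes.
  - by move=> _; exists (fun=> setT) => //; exact: boxT.
  - by rewrite bigcup_const.
  - by move=> _ [B mB <-]; exact: boxE.
  - by move=> _; rewrite -ge0_fin_numE// fin_num_measure.
transitivity (Eint P (F \o phi)).
  have FphiM : bmeas M (F \o phi) := bmeas_comp FM mphi.
  congr fine; rewrite -(integral_pushforward mphi (mu := P) (D := setT) (f := EFin \o F))//.
  - by apply: eq_measure_integral => A mA _; exact: mP.
  - by apply/measurable_EFinP; exact: FM.1.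
  - exact: bmeas_integrable FphiM.
have FphiM : bmeas M (F \o phi) := bmeas_comp FM mphi.
rewrite (Eint_prod _ _ FphiM); apply: eq_Eint => x.
rewrite (Eint_prod _ _ (M := M))//.
apply: (bmeas_comp FphiM (phi := fun z : R * R => (x, z))).
exact: measurable_pair1.
Qed.

End resampling.

(** * Gain terms of the generators, one edge at a time *)

Section jump_operators.
Context {R : realType} {n : nat} (bd : pred 'I_n).
Notation S := (n.-tuple R).
Implicit Types (i j k : 'I_n) (M : R).

Definition jump_bulk i j (f : S * S -> R) (z : S * S) : R :=
  Eint unif (fun u => f (H_bulk i j u z)).

Definition jump_bd i j (f : S * S -> R) (z : S * S) : R :=
  Eint exp1 (fun b => Eint unif (fun u => f (H_bd i j b u z))).

Definition jump_O i j (f : S -> R) (s : S) : R :=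
  Eint unif (fun v => f (H_O bd i j v s)).

Lemma measurable_tnth_comp d (T : measurableType d) (f : T -> S) k :
  measurable_fun setT f -> measurable_fun setT (fun z => tnth (f z) k).
Proof. exact: (measurableT_comp (measurable_tnth k)). Qed.

Lemma measurable_Tbar d (T : measurableType d) (f g : T -> S) i j :
  measurable_fun setT f -> measurable_fun setT g ->
  measurable_fun setT (fun z => Tbar (f z) (g z) i j).
Proof.
move=> mf mg; have mtf k := measurable_tnth_comp k mf.
have mtg k := measurable_tnth_comp k mg.
have minv : measurable_fun setT (fun z => (tnth (f z) i + tnth (f z) j)^-1).
  by apply: (measurableT_comp measurable_inv); exact: measurable_funD.
by apply: measurable_funD; apply: measurable_funM => //; exact: measurable_funM.
Qed.

Lemma measurable_H_bulk i j :
  measurable_fun setT (fun z : (S * S) * R => H_bulk i j z.2 z.1).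
Proof.
rewrite (_ : (fun z => _) = fun z : (S * S) * R =>
  (upd2 z.1.1 i j (z.2 * (tnth z.1.1 i + tnth z.1.1 j))
     ((1 - z.2) * (tnth z.1.1 i + tnth z.1.1 j)),
   upd2 z.1.2 i j (Tbar z.1.1 z.1.2 i j) (Tbar z.1.1 z.1.2 i j))); last first.
  by apply/funext => -[[x s] u].
have m1 : measurable_fun setT (fun z : (S * S) * R => z.1.1).
  exact: measurableT_comp.
have m2 : measurable_fun setT (fun z : (S * S) * R => z.1.2).
  exact: measurableT_comp.
have mt := measurable_tnth_comp _ m1; have mT := measurable_Tbar i j m1 m2.
apply: measurable_fun_pair; apply: measurable_upd2 => //.
- by apply: measurable_funM => //; exact: measurable_funD.
- by apply: measurable_funM; [exact: measurable_funB|exact: measurable_funD].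
Qed.

Lemma measurable_H_bd i j :
  measurable_fun setT (fun z : (S * S) * R * R => H_bd i j z.1.2 z.2 z.1.1).
Proof.
rewrite (_ : (fun z => _) = fun z : (S * S) * R * R =>
  (upd2 z.1.1.1 i j (z.2 * (tnth z.1.1.1 i + tnth z.1.1.1 j)) z.1.2,
   upd2 z.1.1.2 i j (Tbar z.1.1.1 z.1.1.2 i j) (tnth z.1.1.2 j))); last first.
  by apply/funext => -[[[x s] b] u].
have m0 : measurable_fun setT (fun z : (S * S) * R * R => z.1.1).
  exact: measurableT_comp.
have m1 : measurable_fun setT (fun z : (S * S) * R * R => z.1.1.1).
  exact: (measurableT_comp measurable_fst m0).
have m2 : measurable_fun setT (fun z : (S * S) * R * R => z.1.1.2).
  exact: (measurableT_comp measurable_snd m0).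
have mt := measurable_tnth_comp _ m1; have mT := measurable_Tbar i j m1 m2.
have mt2 := measurable_tnth_comp _ m2.
apply: measurable_fun_pair; apply: measurable_upd2 => //.
- by apply: measurable_funM => //; exact: measurable_funD.
- exact: (measurableT_comp measurable_snd measurable_fst).
Qed.

Lemma measurable_H_O i j :
  measurable_fun setT (fun z : S * R => H_O bd i j z.2 z.1).
Proof.
apply/measurable_fun_tnthP => k.
rewrite (_ : _ \o _ = fun z : S * R => if ((k == i) || (k == j)) && ~~ bd k
  then z.2 * tnth z.1 i + (1 - z.2) * tnth z.1 j else tnth z.1 k); last first.
  by apply/funext => z; rewrite /= tnth_mktuple.
have mt l : measurable_fun setT (fun z : S * R => tnth z.1 l).
  exact: measurable_tnth_comp.
case: (_ && ~~ bd k) => //; apply: measurable_funD; apply: measurable_funM => //.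
exact: measurable_funB.
Qed.

Lemma bmeas_jump_bulk i j M f : bmeas M f -> bmeas M (jump_bulk i j f).
Proof. by move=> fM; exact: (bmeas_Eint unif (bmeas_comp fM (measurable_H_bulk i j))). Qed.

Lemma bmeas_jump_bd i j M f : bmeas M f -> bmeas M (jump_bd i j f).
Proof.
move=> fM; have gM := bmeas_Eint unif (bmeas_comp fM (measurable_H_bd i j)).
exact: (bmeas_Eint exp1 gM).
Qed.

Lemma bmeas_jump_O i j M f : bmeas M f -> bmeas M (jump_O i j f).
Proof. by move=> fM; exact: (bmeas_Eint unif (bmeas_comp fM (measurable_H_O i j))). Qed.

(** If [a + b] is 0, division by zero makes both weights of [Tbar] vanish, and they no longer sum to
    1. *)
Lemma Tbar_upd2 (x s : S) i j a b : i != j -> a + b != 0 ->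
  Tbar (upd2 x i j a b) s i j =
  a / (a + b) * tnth s i + (1 - a / (a + b)) * tnth s j.
Proof.
move=> ij ab; rewrite /Tbar !tnth_upd2 !eqxx eq_sym (negbTE ij).
by field.
Qed.

Lemma H_bulk_upd2 (x s : S) i j a b u : i != j -> ~~ bd i -> ~~ bd j ->
  a + b != 0 ->
  H_bulk i j u (upd2 x i j a b, s) =
  (upd2 x i j (u * (a + b)) ((1 - u) * (a + b)), H_O bd i j (a / (a + b)) s).
Proof.
move=> ij bi bj ab; rewrite /= Tbar_upd2// !tnth_upd2 !eqxx eq_sym (negbTE ij).
rewrite upd2_upd2; congr pair; apply: eq_from_tnth => k.
rewrite tnth_upd2 tnth_mktuple.
by case: eqP => [->|_]; [|case: eqP => [->|//]]; rewrite ?bi ?bj.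
Qed.

(** The boundary temperature agrees on both sides: [H_bd] writes back the old value at [j], and
    [H_O] skips [j]. *)
Lemma H_bd_upd2 (x s : S) i j a b c u : i != j -> ~~ bd i -> bd j ->
  a + b != 0 ->
  H_bd i j c u (upd2 x i j a b, s) =
  (upd2 x i j (u * (a + b)) c, H_O bd i j (a / (a + b)) s).
Proof.
move=> ij bi bj ab; rewrite /= Tbar_upd2// !tnth_upd2 !eqxx eq_sym (negbTE ij).
rewrite upd2_upd2; congr pair; apply: eq_from_tnth => k.
rewrite tnth_upd2 tnth_mktuple.
by case: eqP => [->|_]; [|case: eqP => [->|//]]; rewrite ?bi ?bj.
Qed.

End jump_operators.

(** * Intertwining for a single edge *)

Section edge_intertwining.
Context {R : realType} {n : nat} (bd : pred 'I_n) (m : probability (n.-tuple R) R).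
Hypothesis mexp : is_prod_exp1 m.
Notation S := (n.-tuple R).
Variables (i j : 'I_n).
Hypotheses (ij : i != j) (bi : ~~ bd i).

Definition marginal (f : S * S -> R) (s : S) : R := Eint m (fun x => f (x, s)).

Lemma bmeas_marginal M f : bmeas M f -> bmeas M (marginal f).
Proof.
move=> fM; apply: (bmeas_Eint m (f := fun z : S * S => f (z.2, z.1))).
by apply: (bmeas_comp fM (phi := fun z : S * S => (z.2, z.1))); exact: measurable_fun_pair.
Qed.

Lemma eq_Eint_exp1_pair M N (f g : R * R -> R) : bmeas M f -> bmeas N g ->
  (forall a b, 0 < a -> 0 < b -> f (a, b) = g (a, b)) ->
  Eint exp1 (fun a => Eint exp1 (fun b => f (a, b))) =
  Eint exp1 (fun a => Eint exp1 (fun b => g (a, b))).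
Proof.
move=> fM gN fg.
apply: (eq_Eint_exp1 (bmeas_Eint exp1 fM) (bmeas_Eint exp1 gN)) => a a0.
apply: (@eq_Eint_exp1 _ M N) => [| |b b0]; last exact: fg.
- by apply: (bmeas_comp fM); exact: measurable_pair1.
- by apply: (bmeas_comp gN); exact: measurable_pair1.
Qed.

(** Brings the opinion side to the form of the right side of [exp1_split] and [exp1_split_reset]. As
    [H_O] ignores the energies, the average over [v] can be moved inside before resampling. *)
Lemma jump_O_marginal M f s : bmeas M f ->
  jump_O bd i j (marginal f) s =
  Eint m (fun x => Eint exp1 (fun a => Eint exp1 (fun b => Eint unif (fun v =>
    f (upd2 x i j a b, H_O bd i j v s))))).
Proof.
move=> fM; have mHs : measurable_fun setT (fun v : R => H_O bd i j v s).
  by apply: (measurableT_comp (measurable_H_O bd i j) (g := fun v : R => (s, v)));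
    exact: measurable_pair1.
have gM : bmeas M (fun z : S * R => f (z.1, H_O bd i j z.2 s)).
  apply: (bmeas_comp fM (phi := fun z : S * R => (z.1, H_O bd i j z.2 s))).
  by apply: measurable_fun_pair => //; exact: (measurableT_comp mHs).
rewrite -(is_prod_exp1_resample mexp ij (bmeas_Eint unif gM)).
symmetry; apply: (Eint_swap _ _ (M := M) (f := fun x v => f (x, H_O bd i j v s))).
exact: gM.
Qed.

(** After resampling, the left side evaluates [f] at the new energies and at the opinion update of
    weight [a / (a + b)]; [exp1_split] trades these for fresh exponentials and an independent
    uniform weight. *)
Lemma marginal_jump_bulk M f s : bmeas M f -> ~~ bd j ->
  marginal (jump_bulk i j f) s = jump_O bd i j (marginal f) s.
Proof.
move=> fM bj; rewrite (jump_O_marginal _ fM) /marginal.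
have JM := bmeas_jump_bulk i j fM.
have JsM : bmeas M (fun x => jump_bulk i j f (x, s)).
  by apply: (bmeas_comp JM); exact: measurable_pair2.
rewrite [LHS](is_prod_exp1_resample mexp ij JsM); apply: eq_Eint => x.
have mHs : measurable_fun setT (fun v : R => H_O bd i j v s).
  by apply: (measurableT_comp (measurable_H_O bd i j) (g := fun v : R => (s, v)));
    exact: measurable_pair1.
pose G (z : R * R * R) := f (upd2 x i j z.1.1 z.1.2, H_O bd i j z.2 s).
have GM : bmeas M G.
  apply: (bmeas_comp fM (phi := fun z : R * R * R =>
    (upd2 x i j z.1.1 z.1.2, H_O bd i j z.2 s))).
  apply: measurable_fun_pair; last exact: (measurableT_comp mHs).
  by apply: measurable_upd2; solve_measurable.
rewrite -[RHS](exp1_split GM).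
pose G' (z : R * R * R) := G (z.2 * (z.1.1 + z.1.2), (1 - z.2) * (z.1.1 + z.1.2),
  z.1.1 / (z.1.1 + z.1.2)).
have G'M : bmeas M G' by apply: (bmeas_comp GM); solve_measurable.
apply: (@eq_Eint_exp1_pair M M (fun z => jump_bulk i j f (upd2 x i j z.1 z.2, s))
  (fun z => Eint unif (fun u => G' (z, u)))) => [||a b a0 b0].
- apply: (bmeas_comp JsM (phi := fun z : R * R => upd2 x i j z.1 z.2)).
  by apply: measurable_upd2; solve_measurable.
- exact: (bmeas_Eint unif G'M).
apply: eq_Eint => u; rewrite (H_bulk_upd2 _ _ _ ij bi bj)//.
by rewrite gt_eqF// addr_gt0.
Qed.

Lemma marginal_jump_bd M f s : bmeas M f -> bd j ->
  marginal (jump_bd i j f) s = jump_O bd i j (marginal f) s.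
Proof.
move=> fM bj; rewrite (jump_O_marginal _ fM) /marginal.
have JM := bmeas_jump_bd i j fM.
have JsM : bmeas M (fun x => jump_bd i j f (x, s)).
  by apply: (bmeas_comp JM); exact: measurable_pair2.
rewrite [LHS](is_prod_exp1_resample mexp ij JsM); apply: eq_Eint => x.
have mHs : measurable_fun setT (fun v : R => H_O bd i j v s).
  by apply: (measurableT_comp (measurable_H_O bd i j) (g := fun v : R => (s, v)));
    exact: measurable_pair1.
pose G (z : R * R * R) := f (upd2 x i j z.1.1 z.1.2, H_O bd i j z.2 s).
have GM : bmeas M G.
  apply: (bmeas_comp fM (phi := fun z : R * R * R =>
    (upd2 x i j z.1.1 z.1.2, H_O bd i j z.2 s))).
  apply: measurable_fun_pair; last exact: (measurableT_comp mHs).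
  by apply: measurable_upd2; solve_measurable.
rewrite -[RHS](exp1_split_reset GM).
pose G' (z : R * R * R * R) := G (z.2 * (z.1.1.1 + z.1.1.2), z.1.2,
  z.1.1.1 / (z.1.1.1 + z.1.1.2)).
have G'M : bmeas M G' by apply: (bmeas_comp GM); solve_measurable.
apply: (@eq_Eint_exp1_pair M M (fun z => jump_bd i j f (upd2 x i j z.1 z.2, s))
  (fun z => Eint exp1 (fun c => Eint unif (fun u => G' (z, c, u))))) => [||a b a0 b0].
- apply: (bmeas_comp JsM (phi := fun z : R * R => upd2 x i j z.1 z.2)).
  by apply: measurable_upd2; solve_measurable.
- exact: (bmeas_Eint exp1 (bmeas_Eint unif G'M)).
apply: eq_Eint => c; apply: eq_Eint => u; rewrite (H_bd_upd2 _ _ _ _ ij bi bj)//.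
by rewrite gt_eqF// addr_gt0.
Qed.

End edge_intertwining.

(** * Exponential series of a bounded operator *)

Section semigroup.
Context d (U : measurableType d) (R : realType) (L : (U -> R) -> (U -> R)) (C t : R).
Hypotheses (C0 : 0 <= C) (t0 : 0 <= t).
Hypothesis LC : forall M f, bmeas M f -> bmeas (C * M) (L f).

Lemma bmeas_ge0 M (f : U -> R) : bmeas M f -> 0 <= M.
Proof. by move=> [_ /(_ point)]; exact: le_trans. Qed.

Lemma bmeas_iter M f k : bmeas M f -> bmeas (C ^+ k * M) (iter k L f).
Proof.
move=> fM; elim: k => [|k IH]; first by rewrite expr0 mul1r.
by rewrite exprS -mulrA; exact: LC.
Qed.

Lemma bmeas_expL_term M f k : bmeas M f ->
  bmeas (M * exp_coeff (t * C) k) (fun z => t ^+ k / k`!%:R * iter k L f z).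
Proof.
move=> fM; have := bmeasZ (t ^+ k / k`!%:R) (bmeas_iter k fM).
rewrite ger0_norm ?divr_ge0 ?exprn_ge0//; congr (bmeas _ _).
by rewrite /exp_coeff/= exprMn; ring.
Qed.

(** This is [M * expR (t * C)], kept as the limit of the majorant against which the exponential
    series is compared. *)
Definition expL_bound M := limn (series (fun k => M * exp_coeff (t * C) k)).

Lemma is_cvg_expL_bound M : cvgn (series (fun k => M * exp_coeff (t * C) k)).
Proof.
by have := is_cvg_seriesZ (V := R^o) (k := M) (is_cvg_series_exp_coeff (t * C)).
Qed.

Lemma is_cvg_expL M f z : bmeas M f ->
  cvgn (series (fun k => t ^+ k / k`!%:R * iter k L f z)).
Proof.
move=> fM; apply: (@normed_cvg R R).
apply: (@series_le_cvg R _ (fun k => M * exp_coeff (t * C) k)) => [k|k|k|].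
- exact: normr_ge0.
- by rewrite mulr_ge0 ?(bmeas_ge0 fM)// exp_coeff_ge0 ?mulr_ge0.
- exact: (bmeas_expL_term k fM).2.
- exact: is_cvg_expL_bound.
Qed.

(** The bound is uniform in [N], so it can serve as the dominating constant when the limit is
    exchanged with an expectation. *)
Lemma bmeas_series_expL M f N : bmeas M f ->
  bmeas (expL_bound M) (fun z => series (fun k => t ^+ k / k`!%:R * iter k L f z) N).
Proof.
move=> fM; have := bmeas_sum (index_iota 0 N) (P := xpredT)
  (fun k _ => bmeas_expL_term k fM).
move=> [mS SM]; split=> // z; apply: (le_trans (SM z)).
have nd : nondecreasing_seq (series (fun k => M * exp_coeff (t * C) k)).
  apply: nondecreasing_series => k _ _.
  by rewrite mulr_ge0 ?(bmeas_ge0 fM)// exp_coeff_ge0 ?mulr_ge0.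
exact: (nondecreasing_cvgn_le nd (@is_cvg_expL_bound M) N).
Qed.

Lemma bmeas_expL M f : bmeas M f -> bmeas (expL_bound M) (expL L t f).
Proof.
move=> fM; split.
  apply: (measurable_fun_cvg (h := fun N z =>
    series (fun k => t ^+ k / k`!%:R * iter k L f z) N)) => [N|z _].
  - exact: (bmeas_series_expL N fM).1.
  - exact: (@is_cvg_expL M f z fM).
move=> z; apply: (cvgr_to_le (cvg_norm (@is_cvg_expL M f z fM))).
by apply: nearW => N; exact: (bmeas_series_expL N fM).2.
Qed.

End semigroup.

Lemma cvg_Eint d (T : measurableType d) (R : realType) (m : probability T R) (M : R)
    (h : nat -> T -> R) (g : T -> R) :
  (forall k, bmeas M (h k)) -> bmeas M g ->
  (forall x, h k x @[k --> \oo] --> g x) ->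
  Eint m (h k) @[k --> \oo] --> Eint m g.
Proof.
move=> hM gM hg; apply: (fine_cvg (f := fun k => (\int[m]_x (h k x)%:E)%E)).
rewrite (EFin_Eint _ gM).
apply: (dominated_cvg measurableT (g := EFin \o cst M)) => //.
- by move=> k; apply/measurable_EFinP; exact: (hM k).1.
- by move=> x _; apply: cvg_EFin; [exact: nearW|exact: hg].
- exact: finite_measure_integrable_cst.
- by move=> k x _; rewrite /= lee_fin; exact: (hM k).2.
Qed.

(** * Both generators as bounded sums of jump terms *)

Section generators.
Context {R : realType} {n : nat} (bd : pred 'I_n) (e : rel 'I_n).
Notation S := (n.-tuple R).
Notation mu := (@lebesgue_measure R).
Implicit Types (M c : R).

Lemma Rintegral_unif (g : R -> R) : measurable_fun setT g ->
  Rintegral mu `[0, 1] g = Eint unif g.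
Proof.
move=> mg; congr fine; rewrite integral_unif; last exact/measurable_EFinP.
rewrite integral_mkcond; apply: eq_integral => x _; rewrite patchE.
by rewrite /unif_density mem_setE/= in_itv/=; case: ifP => _; rewrite ?mul1e ?mul0e.
Qed.

Lemma Rintegral_exp1 (g : R -> R) : measurable_fun setT g ->
  Rintegral mu `[0, +oo[ (fun b => expR (- b) * g b) = Eint exp1 g.
Proof.
move=> mg; have mEg : measurable_fun setT (EFin \o g) by exact/measurable_EFinP.
congr fine; rewrite integral_exp1// -ae_exponential_pdf//.
rewrite integral_mkcond; apply: eq_integral => x _.
rewrite patchE /exponential_pdf patchE; case: ifP => _; last by rewrite mul0e.
by rewrite mul1r mulN1r EFinM.
Qed.

Lemma L_XT_jump M (f : S * S -> R) z : bmeas M f ->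
  L_XT bd e f z =
  \sum_(i < n) \sum_(j < n | e i j && ~~ bd j) (jump_bulk i j f z - f z) +
  \sum_(i < n) \sum_(j < n | e i j && bd j) (jump_bd i j f z - f z).
Proof.
move=> fM; congr (_ + _); apply: eq_bigr => i _; apply: eq_bigr => j _.
  have gM : bmeas M (fun u => f (H_bulk i j u z)).
    apply: (bmeas_comp (bmeas_comp fM (measurable_H_bulk i j)) (phi := fun u => (z, u))).
    exact: measurable_pair1.
  rewrite Rintegral_unif; last exact: (bmeasB gM (bmeas_cst R (f z))).1.
  by rewrite (EintB _ gM (bmeas_cst R (f z))) Eint_cst.
have gM b : bmeas M (fun u => f (H_bd i j b u z)).
  apply: (bmeas_comp (bmeas_comp fM (measurable_H_bd i j)) (phi := fun u => (z, b, u))).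
  exact: measurable_pair1.
have hM : bmeas M (fun b => Eint unif (fun u => f (H_bd i j b u z))).
  apply: (bmeas_Eint unif (f := fun p : R * R => f (H_bd i j p.1 p.2 z))).
  apply: (bmeas_comp (bmeas_comp fM (measurable_H_bd i j))
    (phi := fun p : R * R => (z, p.1, p.2))).
  by apply: measurable_fun_pair => //; apply: measurable_fun_pair.
under eq_Rintegral => b _.
  rewrite Rintegral_unif; last exact: (bmeasB (gM b) (bmeas_cst R (f z))).1.
  rewrite (EintB _ (gM b) (bmeas_cst R (f z))) Eint_cst.
  over.
rewrite Rintegral_exp1; last exact: (bmeasB hM (bmeas_cst R (f z))).1.
by rewrite (EintB _ hM (bmeas_cst R (f z))) Eint_cst.
Qed.

Lemma L_O_jump M (f : S -> R) s : bmeas M f ->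
  L_O bd e f s = \sum_(i < n) \sum_(j < n | e i j) (jump_O bd i j f s - f s).
Proof.
move=> fM; apply: eq_bigr => i _; apply: eq_bigr => j _.
have gM : bmeas M (fun v => f (H_O bd i j v s)).
  apply: (bmeas_comp (bmeas_comp fM (measurable_H_O bd i j)) (phi := fun v => (s, v))).
  exact: measurable_pair1.
rewrite Rintegral_unif; last exact: (bmeasB gM (bmeas_cst R (f s))).1.
by rewrite (EintB _ gM (bmeas_cst R (f s))) Eint_cst.
Qed.

(* Each edge contributes at most 2 to the operator norm of the generator. *)
Definition rate_XT : R :=
  \sum_(i < n) \sum_(j < n | e i j && ~~ bd j) 2 +
  \sum_(i < n) \sum_(j < n | e i j && bd j) 2.

Definition rate_O : R := \sum_(i < n) \sum_(j < n | e i j) 2.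

Lemma rate_XT_ge0 : 0 <= rate_XT.
Proof. by apply: addr_ge0; apply: sumr_ge0 => i _; apply: sumr_ge0. Qed.

Lemma rate_O_ge0 : 0 <= rate_O.
Proof. by apply: sumr_ge0 => i _; apply: sumr_ge0. Qed.

Lemma bmeas_L_XT M (f : S * S -> R) : bmeas M f -> bmeas (rate_XT * M) (L_XT bd e f).
Proof.
move=> fM; have /funext -> := fun z => L_XT_jump z fM.
have bulkM i j := bmeasB (bmeas_jump_bulk i j fM) fM.
have bdM i j := bmeasB (bmeas_jump_bd i j fM) fM.
have -> : rate_XT * M = \sum_(i < n) \sum_(j < n | e i j && ~~ bd j) (M + M) +
    \sum_(i < n) \sum_(j < n | e i j && bd j) (M + M).
  rewrite mulrDl !big_distrl/=; congr (_ + _); apply: eq_bigr => i _;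
    by rewrite big_distrl/=; apply: eq_bigr => j _; rewrite mulr_natl mulr2n.
exact: (bmeasD (bmeas_sum _ (fun i _ => bmeas_sum _ (fun j _ => bulkM i j)))
  (bmeas_sum _ (fun i _ => bmeas_sum _ (fun j _ => bdM i j)))).
Qed.

Lemma bmeas_L_O M (f : S -> R) : bmeas M f -> bmeas (rate_O * M) (L_O bd e f).
Proof.
move=> fM; have /funext -> := fun s => L_O_jump s fM.
have OM i j := bmeasB (bmeas_jump_O bd i j fM) fM.
have -> : rate_O * M = \sum_(i < n) \sum_(j < n | e i j) (M + M).
  rewrite big_distrl/=; apply: eq_bigr => i _.
  by rewrite big_distrl/=; apply: eq_bigr => j _; rewrite mulr_natl mulr2n.
exact: (bmeas_sum _ (fun i _ => bmeas_sum _ (fun j _ => OM i j))).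
Qed.

Lemma L_OZ M c (f : S -> R) : bmeas M f ->
  L_O bd e (fun s => c * f s) = fun s => c * L_O bd e f s.
Proof.
move=> fM; apply/funext => s; rewrite (L_O_jump _ (bmeasZ c fM)) (L_O_jump _ fM).
rewrite big_distrr/=; apply: eq_bigr => i _; rewrite big_distrr/=.
apply: eq_bigr => j _; rewrite mulrBr; congr (_ - _).
apply: (EintZ _ (M := M)).
apply: (bmeas_comp (bmeas_comp fM (measurable_H_O bd i j)) (phi := fun v => (s, v))).
exact: measurable_pair1.
Qed.

Lemma L_O_cst c : L_O bd e (fun=> c) = fun=> 0.
Proof.
apply/funext => s; rewrite (L_O_jump _ (bmeas_cst _ c)).
by apply: big1 => i _; apply: big1 => j _; rewrite /jump_O Eint_cst subrr.
Qed.

(** Meant for independence: averaging [g z.1 * h z.2] over the energies leaves a constant times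
    [h]. *)
Lemma expL_OZ t M c (f : S -> R) : 0 <= t -> bmeas M f ->
  expL (L_O bd e) t (fun s => c * f s) = fun s => c * expL (L_O bd e) t f s.
Proof.
move=> t0 fM.
have iterZ k : iter k (L_O bd e) (fun s => c * f s) = fun s => c * iter k (L_O bd e) f s.
  by elim: k => // k /= ->; exact: (L_OZ c (bmeas_iter bmeas_L_O k fM)).
apply/funext => s; rewrite /expL.
under eq_fun do rewrite iterZ mulrCA.
exact: (lim_seriesZ (V := R) (f := fun k => t ^+ k / k`!%:R * iter k (L_O bd e) f s) c
  (@is_cvg_expL _ _ _ _ _ _ rate_O_ge0 t0 bmeas_L_O M f s fM)).
Qed.

Lemma expL_O_cst t c : expL (L_O bd e) t (fun=> c) = fun=> c.
Proof.
have iterE k : iter k.+1 (L_O bd e) (fun=> c) = fun=> 0.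
  by elim: k => [|k IH]; [exact: L_O_cst|rewrite iterS IH L_O_cst].
(* The partial sum of index 0 is empty, so the partial sums equal [c] only from index 1 on; hence
   the shift. *)
apply/funext => s; apply/cvg_lim => //; rewrite -cvg_shiftS/=.
rewrite (_ : (fun k => _) = fun=> c); first exact: cvg_cst.
apply/funext => k; rewrite /series/= big_nat_recl// expr0 fact0 divr1 mul1r.
rewrite big1 ?addr0// => l _; by rewrite (iterE l) mulr0.
Qed.

End generators.

(** * Intertwining of generators, semigroups and path expectations *)

Section intertwining.
Context {R : realType} {n : nat} (bd : pred 'I_n) (e : rel 'I_n).
Variable m : probability (n.-tuple R) R.
Hypotheses (ge : graph_ok bd e) (mexp : is_prod_exp1 m).
Notation S := (n.-tuple R).

Lemma graph_ok_neq i j : e i j -> i != j.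
Proof. by move=> eij; apply/eqP => ij; have := ge.1 _ _ eij; case: _ / ij eij => ->. Qed.

Lemma marginal_L_XT M (f : S * S -> R) : bmeas M f ->
  marginal m (L_XT bd e f) = L_O bd e (marginal m f).
Proof.
move=> fM; apply/funext => s.
rewrite (L_O_jump _ _ _ (bmeas_marginal m fM)) /marginal.
have slice N (g : S * S -> R) : bmeas N g -> bmeas N (fun x => g (x, s)).
  by move=> gN; apply: (bmeas_comp gN); exact: measurable_pair2.
under eq_Eint do rewrite (L_XT_jump _ _ _ fM).
have bulkM i j := bmeasB (slice _ _ (bmeas_jump_bulk i j fM)) (slice _ _ fM).
have bdM i j := bmeasB (slice _ _ (bmeas_jump_bd i j fM)) (slice _ _ fM).
rewrite (EintD _ (bmeas_sum _ (fun i _ => bmeas_sum _ (fun j _ => bulkM i j)))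
  (bmeas_sum _ (fun i _ => bmeas_sum _ (fun j _ => bdM i j)))).
rewrite (Eint_sum _ _ (fun i _ => bmeas_sum _ (fun j _ => bulkM i j))).
rewrite (Eint_sum _ _ (fun i _ => bmeas_sum _ (fun j _ => bdM i j))).
rewrite -big_split/=; apply: eq_bigr => i _.
(* The opinion generator does not separate the two kinds of edges; its sum is split by whether [j]
   is a boundary vertex. *)
rewrite [RHS](bigID bd)/= addrC; congr (_ + _).
  rewrite (Eint_sum _ _ (fun j _ => bdM i j)); apply: eq_bigr => j /andP[eij bj].
  rewrite (EintB _ (slice _ _ (bmeas_jump_bd i j fM)) (slice _ _ fM)).
  congr (_ - _); apply: (marginal_jump_bd mexp (graph_ok_neq eij) _ _ fM bj).
  exact: ge.2 eij.
rewrite (Eint_sum _ _ (fun j _ => bulkM i j)); apply: eq_bigr => j /andP[eij bj].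
rewrite (EintB _ (slice _ _ (bmeas_jump_bulk i j fM)) (slice _ _ fM)).
congr (_ - _); apply: (marginal_jump_bulk mexp (graph_ok_neq eij) _ _ fM bj).
exact: ge.2 eij.
Qed.

(** Intertwining iterates along powers of the generators and so holds for partial sums; bounded
    convergence, with [expL_bound] as the bound, carries it to the limit. *)
Lemma marginal_expL t M (f : S * S -> R) : 0 <= t -> bmeas M f ->
  marginal m (expL (L_XT bd e) t f) = expL (L_O bd e) t (marginal m f).
Proof.
move=> t0 fM; have LC := @bmeas_L_XT R n bd e; have C0 := @rate_XT_ge0 R n bd e.
have iterE k : marginal m (iter k (L_XT bd e) f) = iter k (L_O bd e) (marginal m f).
  by elim: k => // k IH; rewrite iterS (marginal_L_XT (bmeas_iter LC k fM)) IH.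
apply/funext => s; symmetry; apply/cvg_lim => //.
have slice N (g : S * S -> R) : bmeas N g -> bmeas N (fun x => g (x, s)).
  by move=> gN; apply: (bmeas_comp gN); exact: measurable_pair2.
rewrite (_ : series _ = fun N => Eint m (fun x =>
    series (fun k => t ^+ k / k`!%:R * iter k (L_XT bd e) f (x, s)) N)).
  apply: cvg_Eint => [N||x].
  - exact: (slice _ _ (bmeas_series_expL C0 t0 LC N fM)).
  - exact: (slice _ _ (bmeas_expL C0 t0 LC fM)).
  - exact: (@is_cvg_expL _ _ _ _ _ _ C0 t0 LC M f (x, s) fM).
apply/funext => N; rewrite /series/=.
rewrite (Eint_sum _ _ (fun k _ => slice _ _ (bmeas_expL_term t0 LC k fM))).
apply: eq_bigr => k _; rewrite (EintZ _ _ (slice _ _ (bmeas_iter LC k fM))).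
by rewrite -iterE.
Qed.

(** Even for observables of the temperature, the expectation [F] of the remaining factors depends on
    the energies, so the induction concerns its average. The next factor [g s] is constant in x and
    leaves the average, after which [marginal_expL] applies; boundedness of [F] is carried along for
    that purpose. *)
Lemma marginal_markov_chain (l : seq (R * (S -> R))) :
  (forall k, (k < size l)%N ->
     0 <= (nth (0, fun=> 0) l k).1 /\ bounded_meas (nth (0, fun=> 0) l k).2) ->
  let F := markov_chain (expL (L_XT bd e))
    [seq (p.1, fun z : S * S => p.2 z.2) | p <- l] in
  bounded_meas F /\ marginal m F = markov_chain (expL (L_O bd e)) l.
Proof.
elim: l => [_|[t g] l IH ltg] /=.
  split; first by split => //; exists 1 => z; rewrite normr1.
  by apply/funext => s; exact: Eint_cst.
have [t0 [mg [N gN]]] := ltg 0%N isT.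
have [k kl|[mF [K FK]] FE] := IH; first exact: (ltg k.+1).
move: mF FK FE; set F := markov_chain _ _ => mF FK FE.
have FM : bmeas K F by [].
have hM : bmeas (N * K) (fun z : S * S => g z.2 * F z).
  by apply: bmeasM => //; exact: (bmeas_comp (conj mg gN : bmeas N g)).
split.
  have [m1 b1] := bmeas_expL (@rate_XT_ge0 R n bd e) t0 (@bmeas_L_XT R n bd e) hM.
  by split => //; exists (expL_bound (rate_XT bd e) t (N * K)).
rewrite (marginal_expL t0 hM); congr expL; apply/funext => s.
have FsM : bmeas K (fun x => F (x, s)).
  by apply: (bmeas_comp FM); exact: measurable_pair2.
by rewrite -FE; exact: (EintZ m (g s) FsM).
Qed.

End intertwining.

Theorem theorem2p4 (R : realType) (n : nat) (bd : pred 'I_n) (e : rel 'I_n)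
  (Tb : 'I_n -> R) (muX nu : probability (n.-tuple R) R) :
  graph_ok bd e ->
  (forall j, bd j -> 0 < Tb j) ->
  is_prod_exp1 muX ->
  nu (~` adm_set bd Tb) = 0%E ->
  (* for every t >= 0, X(t) and T(t) are independent *)
  (forall t : R, 0 <= t ->
     forall g h : n.-tuple R -> R, bounded_meas g -> bounded_meas h ->
       Eint nu (fun s => Eint muX (fun x =>
         expL (L_XT bd e) t (fun z => g z.1 * h z.2) (x, s)))
       = Eint nu (fun s => Eint muX (fun x =>
           expL (L_XT bd e) t (fun z => g z.1) (x, s)))
         * Eint nu (fun s => Eint muX (fun x =>
           expL (L_XT bd e) t (fun z => h z.2) (x, s)))) /\
  (* (T(t))_t has the law of the opinion process started from nu
     (equality of all finite-dimensional distributions) *)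
  (forall l : seq (R * (n.-tuple R -> R)),
     (forall k, (k < size l)%N ->
        0 <= (nth (0, fun=> 0) l k).1 /\ bounded_meas (nth (0, fun=> 0) l k).2) ->
     Eint nu (fun s => Eint muX (fun x =>
       markov_chain (expL (L_XT bd e))
         [seq (p.1, fun z : n.-tuple R * n.-tuple R => p.2 z.2) | p <- l] (x, s)))
     = Eint nu (markov_chain (expL (L_O bd e)) l)) /\
  (* law of (X(t),T(t)) is mu^X (dx) [nu e^{tL^O}](ds) *)
  (forall t : R, 0 <= t ->
     forall f : n.-tuple R * n.-tuple R -> R, bounded_meas f ->
       Eint nu (fun s => Eint muX (fun x => expL (L_XT bd e) t f (x, s)))
       = Eint nu (expL (L_O bd e) t (fun s => Eint muX (fun x => f (x, s))))).
Proof.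
move=> ge _ mexp _.
(* The joint law at time [t]; independence is read off from it on product observables. *)
have law t M (f : n.-tuple R * n.-tuple R -> R) : 0 <= t -> bmeas M f ->
    Eint nu (marginal muX (expL (L_XT bd e) t f)) =
    Eint nu (expL (L_O bd e) t (marginal muX f)).
  by move=> t0 fM; rewrite (marginal_expL ge mexp t0 fM).
split; last split.
- move=> t t0 g h [mg [M gM]] [mh [N hN]].
  have gB : bmeas M (fun z : n.-tuple R * n.-tuple R => g z.1).
    exact: (bmeas_comp (conj mg gM : bmeas M g)).
  have hB : bmeas N (fun z : n.-tuple R * n.-tuple R => h z.2).
    exact: (bmeas_comp (conj mh hN : bmeas N h)).
  have hN' : bmeas N h by [].
  rewrite [LHS](law _ _ _ t0 (bmeasM gB hB)).
  rewrite [X in _ = X * _](law _ _ _ t0 gB) [X in _ = _ * X](law _ _ _ t0 hB).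
  have -> : marginal muX (fun z => g z.1) = fun=> Eint muX g by [].
  have -> : marginal muX (fun z => h z.2) = h.
    by apply/funext => s; exact: (Eint_cst muX (h s)).
  have -> : marginal muX (fun z => g z.1 * h z.2) = fun s => Eint muX g * h s.
    apply/funext => s; rewrite /marginal mulrC -(EintZ muX (h s) (conj mg gM : bmeas M g)).
    by apply: eq_Eint => x; exact: mulrC.
  (* The constant [Eint muX g] is fixed by the opinion semigroup, which says that the energies keep
     the law [muX]. *)
  rewrite (expL_OZ bd e _ t0 hN') expL_O_cst Eint_cst.
  exact: (EintZ nu _ (bmeas_expL (rate_O_ge0 e) t0 (@bmeas_L_O R n bd e) hN')).
- by move=> l lP; have [_ <-] := marginal_markov_chain ge mexp lP.
- by move=> t t0 f [mf [M fM]]; exact: (law t M f t0 (conj mf fM)).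
Qed.
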